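(* Let $(\mathfrak{g},[\cdot,\cdot])$ be a Loday algebra, and let $\mathcal{A}^{poly}(\mathfrak{g}^* )=S(\mathfrak{g}_{Lie})\otimes\mathfrak{g}$ be equipped with the operations $*$ and $\{\cdot,\cdot\}$ defined in the context. Then $(\mathcal{A}^{poly}(\mathfrak{g}^* ),*,\{\cdot,\cdot\})$ is the free dual-prePoisson algebra over the Loday algebra $\mathfrak{g}$, and $\mathfrak{g}$ is a Loday subalgebra of it. That is: (1) $(\mathcal{A}^{poly}(\mathfrak{g}^* ),*,\{\cdot,\cdot\})$ is a dual-prePoisson algebra (in particular it is an associative algebra and a Loday algebra, and the Loday bracket is a biderivation of $*$ in the sense of the axioms (i) and (ii) in the context); (2) the map $\iota:\mathfrak{g}\to\mathcal{A}^{poly}(\mathfrak{g}^* )$, $x\mapsto 1\otimes x$, is an injective homomorphism of Loday algebras; (3) for every dual-prePoisson algebra $P$ and every homomorphism of Loday algebras $\phi:\mathfrak{g}\to P$ there exists a unique homomorphism of dual-prePoisson algebras $\hat\phi:\mathcal{A}^{poly}(\mathfrak{g}^* )\to P$ such that $\hat\phi\circ\iota=\phi$.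
   Context: All vector spaces are over a fixed field of characteristic $0$. A Loday (Leibniz) algebra is a vector space $\mathfrak{g}$ with a bilinear bracket satisfying $[x,[y,z]]=[[x,y],z]+[y,[x,z]]$. Homomorphisms are linear maps preserving the bracket. A perm-algebra is an associative (not necessarily unital) algebra $(A,* )$ with $(x*y)*z=(y*x)*z$. A dual-prePoisson algebra is a perm-algebra $(A,* )$ with a Loday bracket $\{\cdot,\cdot\}$ such that for all $x,y,z\in A$: (i) $\{x,y*z\}=\{x,y\}*z+y*\{x,z\}$; (ii) $\{x*y,z\}=x*\{y,z\}+y*\{x,z\}$; (iii) $\{x,y\}*z=-\{y,x\}*z$. Homomorphisms are linear maps preserving both operations. For a Loday algebra $\mathfrak{g}$, let $\mathfrak{g}^{ann}$ be the subspace spanned by all $[x,y]+[y,x]$; it is a two-sided ideal and $\mathfrak{g}_{Lie}:=\mathfrak{g}/\mathfrak{g}^{ann}$ is a Lie algebra. Write $\bar x$ for the image of $x\in\mathfrak{g}$ in $\mathfrak{g}_{Lie}$. The bracket $[x,y]$ depends on $x$ only through $\bar x$. $S(\mathfrak{g}_{Lie})$ is the unital symmetric algebra with its Lie-Poisson bracket (the unique Poisson bracket extending the Lie bracket of $\mathfrak{g}_{Lie}$), also denoted $\{\cdot,\cdot\}$. Put $\mathcal{A}^{poly}(\mathfrak{g}^* ):=S(\mathfrak{g}_{Lie})\otimes\mathfrak{g}$, an $S(\mathfrak{g}_{Lie})$-module by $f(g\otimes y)=fg\otimes y$, with $y\in\mathfrak{g}$ identified with $1\otimes y$. Define for $f,g\in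 S(\mathfrak{g}_{Lie})$, $x,y,x_i\in\mathfrak{g}$: $(f\otimes x)*(g\otimes y):=f\bar xg\otimes y$; $\{\bar x_1\cdots\bar x_n,y\}:=\sum_{i=1}^n\bar x_1\cdots\bar x_{i-1}\bar x_{i+1}\cdots\bar x_n\otimes[x_i,y]$ (extended linearly to define $\{f,y\}$, with $\{1,y\}=0$); $\{f,g\otimes y\}:=\{f,g\}\otimes y+g\{f,y\}$; $\{f\otimes x,g\otimes y\}:=\{f\bar x,g\otimes y\}$. *)

(* Defs.v *)
From HB Require Import structures.
From mathcomp Require Import all_boot all_algebra.
From mathcomp Require Import boolp.
From mathcomp Require Import ring.

Set Implicit Arguments.
Unset Strict Implicit.
Unset Printing Implicit Defensive.

Import GRing.Theory.
Local Open Scope ring_scope.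
Local Open Scope quotient_scope.

(******************************************************************************)
(* Algebras over K are given by a K-vector space (an lmodType K, of any       *)
(* dimension) together with explicit operations.                              *)
(*                                                                            *)
(*          is_loday br <-> br is a (left) Loday = Leibniz bracket            *)
(*          is_perm mul <-> mul is a (not necessarily unital) perm product    *)
(* is_dual_prePoisson mul br <-> mul and br form a dual-prePoisson algebra    *)
(*               ann br == g^ann, as a (collective) predicate on g            *)
(*              gLie br == g_Lie, the quotient of g by g^ann                  *)
(*             bar br x == the image of x : g in g_Lie                        *)
(*              {sym V} == the unital symmetric algebra of V                  *)
(*               sgen v == the image of v : V in {sym V}                      *)
(*          symlift phi == the algebra morphism {sym V} -> B extending phi    *)
(*         symder act d == the derivation {sym V} -> M extending d : V -> M   *)
(*           tensor U W == the tensor product of U and W over K               *)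
(*                u ⊗ w == the pure tensor                                    *)
(*              tlift b == the linear map tensor U W -> M induced by b        *)
(*            sbar br x == the image of x : g in S(g_Lie)                     *)
(*       lie_poisson br == the Lie-Poisson bracket of S(g_Lie)                *)
(*             Apoly br == S(g_Lie) ⊗ g                                       *)
(*         poly_star br == the product * of Apoly br, cf. poly_star_pure      *)
(*      poly_bracket br == the bracket of Apoly br, cf. poly_bracket_pure     *)
(*         poly_iota br == x |-> 1 ⊗ x                                        *)
(*                                                                            *)
(* The maps out of quotients (lie_br, symlift, symder, tlift, ...) compute on *)
(* a chosen representative; that they do not depend on it, hence satisfy      *)
(* their defining formulas, is proved under the relevant hypotheses.          *)
(******************************************************************************)

Section Algebras.
Context {K : fieldType}.

Definition bilinear_op (U V W : lmodType K) (b : U -> V -> W) : Prop :=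
  (forall u, linear (b u)) /\ (forall v, linear (b^~ v)).

Record is_loday (V : lmodType K) (br : V -> V -> V) : Prop := IsLoday {
  loday_bilinear : bilinear_op br;
  loday_leibniz : forall x y z,
    br x (br y z) = br (br x y) z + br y (br x z)
}.

Record is_perm (A : lmodType K) (mul : A -> A -> A) : Prop := IsPerm {
  perm_bilinear : bilinear_op mul;
  perm_assoc : associative mul;
  perm_swap : forall x y z, mul (mul x y) z = mul (mul y x) z
}.

Record is_dual_prePoisson (A : lmodType K) (mul br : A -> A -> A) : Prop :=
  IsDualPrePoisson {
  dpp_perm : is_perm mul;
  dpp_loday : is_loday br;
  dpp_derr : forall x y z, br x (mul y z) = mul (br x y) z + mul y (br x z);
  dpp_derl : forall x y z, br (mul x y) z = mul x (br y z) + mul y (br x z);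
  dpp_skew : forall x y z, mul (br x y) z = - mul (br y x) z
}.

Definition loday_hom (V W : lmodType K) (brV : V -> V -> V) (brW : W -> W -> W)
    (f : V -> W) : Prop :=
  linear f /\ {morph f : x y / brV x y >-> brW x y}.

Definition dual_prePoisson_hom (A B : lmodType K) (mulA brA : A -> A -> A)
    (mulB brB : B -> B -> B) (f : A -> B) : Prop :=
  [/\ linear f, {morph f : x y / mulA x y >-> mulB x y}
    & {morph f : x y / brA x y >-> brB x y}].

Section LinearTheory.
Variables (U W : lmodType K) (f : U -> W).
Hypothesis lf : linear f.

Lemma lin0 : f 0 = 0.
Proof.
apply: (addrI (f 0)); rewrite addr0.
by have := lf 1 0 0; rewrite !scale1r addr0 => <-.
Qed.
Lemma linD u v : f (u + v) = f u + f v.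
Proof. by have := lf 1 u v; rewrite !scale1r. Qed.
Lemma linZ a u : f (a *: u) = a *: f u.
Proof. by have := lf a u 0; rewrite !addr0 lin0 addr0. Qed.
Lemma linN u : f (- u) = - f u.
Proof. by rewrite -scaleN1r linZ scaleN1r. Qed.
Lemma linB u v : f (u - v) = f u - f v.
Proof. by rewrite linD linN. Qed.
Lemma lin_sum I (r : seq I) (P : pred I) F :
  f (\sum_(i <- r | P i) F i) = \sum_(i <- r | P i) f (F i).
Proof. exact: (big_morph f linD lin0). Qed.
End LinearTheory.

End Algebras.

(* -------------------------------------------------------------------------- *)

Section LieQuotient.
Variables (K : fieldType) (g : lmodType K) (br : g -> g -> g).

Definition ann : {pred g} := fun z =>
  `[< exists s : seq (K * (g * g)),
        z = \sum_(t <- s) t.1 *: (br t.2.1 t.2.2 + br t.2.2 t.2.1) >].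

Fact ann_submod : submod_closed ann.
Proof.
split; first by apply/asboolP; exists [::]; rewrite big_nil.
move=> a u v /asboolP[s ->] /asboolP[t ->]; apply/asboolP.
exists ([seq (a * x.1, x.2) | x <- s] ++ t); rewrite big_cat big_map /=.
by congr (_ + _); rewrite scaler_sumr; apply: eq_bigr => i _; rewrite scalerA.
Qed.
HB.instance Definition _ := GRing.isSubmodClosed.Build K g ann ann_submod.

Definition gLie : Type := Quotient.quot ann.
HB.instance Definition _ := GRing.Zmodule.on gLie.

Definition bar (x : g) : gLie := \pi_(Quotient.quot ann) x.

Lemma bar_eq x y : bar x = bar y <-> x - y \in ann.
Proof.
rewrite Quotient.idealrBE; split=> [e|/eqP e]; first by apply/eqP.
exact: e.
Qed.

Lemma bar_repr (u : gLie) : bar (repr u) = u.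
Proof. exact: reprK. Qed.

Lemma bar_ind (P : gLie -> Prop) : (forall x, P (bar x)) -> forall u, P u.
Proof. by move=> Pb u; rewrite -[u]bar_repr. Qed.

Lemma repr_bar x : repr (bar x) - x \in ann.
Proof. by apply/bar_eq; rewrite bar_repr. Qed.

Lemma barD x y : bar (x + y) = bar x + bar y.
Proof. by rewrite /bar !piE. Qed.

Definition gLie_scale (a : K) (u : gLie) : gLie := bar (a *: repr u).

Lemma gLie_scale_bar a x : gLie_scale a (bar x) = bar (a *: x).
Proof. by apply/bar_eq; rewrite -scalerBr rpredZ ?repr_bar. Qed.

Fact gLie_scalerA a b v : gLie_scale a (gLie_scale b v) = gLie_scale (a * b) v.
Proof. by elim/bar_ind: v => x; rewrite !gLie_scale_bar scalerA. Qed.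
Fact gLie_scale1r : left_id 1 gLie_scale.
Proof. by elim/bar_ind=> x; rewrite gLie_scale_bar scale1r. Qed.
Fact gLie_scalerDr : right_distributive gLie_scale +%R.
Proof.
by move=> a; elim/bar_ind=> x; elim/bar_ind=> y;
  rewrite -barD !gLie_scale_bar scalerDr barD.
Qed.
Fact gLie_scalerDl v : {morph gLie_scale^~ v : a b / a + b}.
Proof. by elim/bar_ind: v => x a b; rewrite !gLie_scale_bar scalerDl barD. Qed.

HB.instance Definition _ := GRing.Zmodule_isLmodule.Build K gLie
  gLie_scalerA gLie_scale1r gLie_scalerDr gLie_scalerDl.

Lemma bar_linear : linear bar.
Proof. by move=> a x y; rewrite barD -gLie_scale_bar. Qed.

(* The action of g_Lie on g induced by the left multiplications, and the
   bracket of g_Lie; they do not depend on the representatives when br is a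
   Loday bracket, cf. lie_act_bar and lie_br_bar. *)
Definition lie_act (u : gLie) (y : g) : g := br (repr u) y.
Definition lie_br (u v : gLie) : gLie := bar (br (repr u) (repr v)).

Hypothesis Hg : is_loday br.
Let br_lr x : linear (br x). Proof. by case: Hg => -[]. Qed.
Let br_ll y : linear (br^~ y). Proof. by case: Hg => -[]. Qed.

Lemma ann_act z y : z \in ann -> br z y = 0.
Proof.
move=> /asboolP[s ->]; rewrite (lin_sum (br_ll y)) /= big1 // => -[a [u v]] _ /=.
rewrite (linZ (br_ll y)) /= (linD (br_ll y)) /=.
have := loday_leibniz Hg u v y; rewrite (loday_leibniz Hg v u y) addrA.
by rewrite -[LHS]add0r => /addIr <-; rewrite scaler0.
Qed.

Lemma ann_idealr x z : z \in ann -> br x z \in ann.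
Proof.
move=> /asboolP[s ->]; rewrite (lin_sum (br_lr x)) /=.
apply: rpred_sum => -[a [u v]] _ /=.
rewrite (linZ (br_lr x)) /= rpredZ // (linD (br_lr x)) /= !(loday_leibniz Hg x).
rewrite [_ + br v _]addrC addrACA [br u _ + _]addrC.
by apply: rpredD; apply/asboolP;
  [exists [:: (1, (br x u, v))] | exists [:: (1, (br x v, u))]];
  rewrite big_seq1 scale1r.
Qed.

Lemma lie_act_bar x y : lie_act (bar x) y = br x y.
Proof.
by apply/eqP; rewrite -subr_eq0 -(linB (br_ll y)) /= ann_act // repr_bar.
Qed.

Lemma lie_br_bar x y : lie_br (bar x) (bar y) = bar (br x y).
Proof.
have := lie_act_bar x (repr (bar y)); rewrite /lie_act /lie_br => ->.
by apply/bar_eq; rewrite -(linB (br_lr x)) ann_idealr ?repr_bar.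
Qed.

Lemma lie_act_bilinear : bilinear_op lie_act.
Proof.
split=> [u|y].
  by elim/bar_ind: u => x a y z; rewrite !lie_act_bar (br_lr x).
move=> a; elim/bar_ind=> x; elim/bar_ind=> z /=.
by rewrite -bar_linear !lie_act_bar (br_ll y).
Qed.

Lemma lie_br_bilinear : bilinear_op lie_br.
Proof.
split=> [u|u]; elim/bar_ind: u => x a; elim/bar_ind=> y; elim/bar_ind=> z /=;
  rewrite -bar_linear !lie_br_bar -bar_linear; congr bar; first exact: br_lr.
exact: br_ll.
Qed.

Lemma lie_br_skew u v : lie_br u v = - lie_br v u.
Proof.
elim/bar_ind: u => x; elim/bar_ind: v => y; rewrite !lie_br_bar.
rewrite -(linN bar_linear); apply/bar_eq; rewrite opprK.
by apply/asboolP; exists [:: (1, (x, y))]; rewrite big_seq1 scale1r.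
Qed.

Lemma lie_br_jacobi u v w :
  lie_br u (lie_br v w) = lie_br (lie_br u v) w + lie_br v (lie_br u w).
Proof.
elim/bar_ind: u => x; elim/bar_ind: v => y; elim/bar_ind: w => z.
by rewrite !lie_br_bar -(linD bar_linear) (loday_leibniz Hg).
Qed.

End LieQuotient.

(* -------------------------------------------------------------------------- *)

(* The symmetric algebra is the unital commutative K-algebra presented by the
   elements of V as generators and the linear relations of V: formal expressions
   modulo the congruence generated by the axioms of commutative algebras and
   the linearity of the generators. *)
Section SymmetricAlgebra.
Variables (K : fieldType) (V : lmodType K).

Inductive sexp : Type :=
| SVar of V
| SCst of K
| SAdd of sexp & sexp
| SMul of sexp & sexp.

Inductive scong : sexp -> sexp -> Prop :=
| SC_refl x : scong x x
| SC_sym x y : scong x y -> scong y x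
| SC_trans x y z : scong x y -> scong y z -> scong x z
| SC_add x x' y y' : scong x x' -> scong y y' -> scong (SAdd x y) (SAdd x' y')
| SC_mul x x' y y' : scong x x' -> scong y y' -> scong (SMul x y) (SMul x' y')
| SC_addA x y z : scong (SAdd x (SAdd y z)) (SAdd (SAdd x y) z)
| SC_addC x y : scong (SAdd x y) (SAdd y x)
| SC_add0 x : scong (SAdd (SCst 0) x) x
| SC_addN x : scong (SAdd (SMul (SCst (-1)) x) x) (SCst 0)
| SC_mulA x y z : scong (SMul x (SMul y z)) (SMul (SMul x y) z)
| SC_mulC x y : scong (SMul x y) (SMul y x)
| SC_mul1 x : scong (SMul (SCst 1) x) x
| SC_mulDl x y z : scong (SMul (SAdd x y) z) (SAdd (SMul x z) (SMul y z))
| SC_cstD a b : scong (SCst (a + b)) (SAdd (SCst a) (SCst b))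
| SC_cstM a b : scong (SCst (a * b)) (SMul (SCst a) (SCst b))
| SC_varD u v : scong (SVar (u + v)) (SAdd (SVar u) (SVar v))
| SC_varZ a v : scong (SVar (a *: v)) (SMul (SCst a) (SVar v)).

HB.instance Definition _ := gen_eqMixin sexp.
HB.instance Definition _ := gen_choiceMixin sexp.

Definition scongb : rel sexp := fun x y => `[< scong x y >].
Fact scongb_refl : reflexive scongb.
Proof. by move=> x; apply/asboolP/SC_refl. Qed.
Fact scongb_sym : symmetric scongb.
Proof. by move=> x y; apply/asboolP/asboolP => /SC_sym. Qed.
Fact scongb_trans : transitive scongb.
Proof. by move=> y x z /asboolP h /asboolP h'; apply/asboolP/(SC_trans h). Qed.
Canonical scongb_equiv := EquivRel scongb scongb_refl scongb_sym scongb_trans.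

Definition symalg : Type := {eq_quot scongb}.
HB.instance Definition _ := Choice.on symalg.

Let cls (x : sexp) : symalg := \pi_({eq_quot scongb}) x.

Let cls_eq x y : cls x = cls y <-> scong x y.
Proof.
split=> [/eqmodP/asboolP //|h]; apply/eqmodP; exact/asboolP.
Qed.
Let cls_ind (P : symalg -> Prop) : (forall x, P (cls x)) -> forall f, P f.
Proof. by move=> h f; rewrite -[f]reprK; apply: h. Qed.
Let repr_cls x : scong (repr (cls x)) x.
Proof. by apply/cls_eq; rewrite /cls reprK. Qed.

Definition symalg_cst (a : K) : symalg := cls (SCst a).
Definition symalg_add (f h : symalg) : symalg := cls (SAdd (repr f) (repr h)).
Definition symalg_mul (f h : symalg) : symalg := cls (SMul (repr f) (repr h)).
Definition symalg_opp (f : symalg) : symalg := symalg_mul (symalg_cst (-1)) f.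
Definition symalg_scale (a : K) (f : symalg) : symalg :=
  symalg_mul (symalg_cst a) f.

Let addE x y : symalg_add (cls x) (cls y) = cls (SAdd x y).
Proof. by apply/cls_eq/SC_add; exact: repr_cls. Qed.
Let mulE x y : symalg_mul (cls x) (cls y) = cls (SMul x y).
Proof. by apply/cls_eq/SC_mul; exact: repr_cls. Qed.

Fact symalg_addA : associative symalg_add.
Proof.
by elim/cls_ind=> x; elim/cls_ind=> y; elim/cls_ind=> z;
  rewrite !addE; apply/cls_eq/SC_addA.
Qed.
Fact symalg_addC : commutative symalg_add.
Proof.
by elim/cls_ind=> x; elim/cls_ind=> y; rewrite !addE; apply/cls_eq/SC_addC.
Qed.
Fact symalg_add0 : left_id (symalg_cst 0) symalg_add.
Proof. by elim/cls_ind=> x; rewrite addE; apply/cls_eq/SC_add0. Qed.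
Fact symalg_addN : left_inverse (symalg_cst 0) symalg_opp symalg_add.
Proof.
by elim/cls_ind=> x; rewrite /symalg_opp mulE addE; apply/cls_eq/SC_addN.
Qed.
HB.instance Definition _ := GRing.isZmodule.Build symalg
  symalg_addA symalg_addC symalg_add0 symalg_addN.

Fact symalg_mulA : associative symalg_mul.
Proof.
by elim/cls_ind=> x; elim/cls_ind=> y; elim/cls_ind=> z;
  rewrite !mulE; apply/cls_eq/SC_mulA.
Qed.
Fact symalg_mulC : commutative symalg_mul.
Proof.
by elim/cls_ind=> x; elim/cls_ind=> y; rewrite !mulE; apply/cls_eq/SC_mulC.
Qed.
Fact symalg_mul1 : left_id (symalg_cst 1) symalg_mul.
Proof. by elim/cls_ind=> x; rewrite mulE; apply/cls_eq/SC_mul1. Qed.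
Fact symalg_mulDl : left_distributive symalg_mul +%R.
Proof.
elim/cls_ind=> x; elim/cls_ind=> y; elim/cls_ind=> z.
by rewrite {1 2}/+%R /= addE !mulE addE; apply/cls_eq/SC_mulDl.
Qed.

Let const_term : sexp -> K :=
  fix F x := match x with
  | SVar _ => 0 | SCst a => a | SAdd x y => F x + F y | SMul x y => F x * F y
  end.
Let const_term_cong x y : scong x y -> const_term x = const_term y.
Proof.
elim=> //=; try by move=> *; ring.
- by move=> ? ? ? _ -> _ ->.
- by move=> ? ? ? ? _ -> _ ->.
- by move=> ? ? ? ? _ -> _ ->.
Qed.

Fact symalg_1neq0 : symalg_cst 1 != 0.
Proof.
apply/eqP => /cls_eq/const_term_cong /= /eqP; exact/negP/oner_neq0.
Qed.
HB.instance Definition _ := GRing.Zmodule_isComNzRing.Build symalg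
  symalg_mulA symalg_mulC symalg_mul1 symalg_mulDl symalg_1neq0.

Let cstD a b : symalg_cst (a + b) = symalg_cst a + symalg_cst b.
Proof. by rewrite {2}/+%R /= addE; apply/cls_eq/SC_cstD. Qed.
Let cstM a b : symalg_cst (a * b) = symalg_cst a * symalg_cst b.
Proof. by rewrite {2}/*%R /= mulE; apply/cls_eq/SC_cstM. Qed.

Fact symalg_scalerA a b f :
  symalg_scale a (symalg_scale b f) = symalg_scale (a * b) f.
Proof. by rewrite /symalg_scale cstM; apply: mulrA. Qed.
Fact symalg_scale1r : left_id 1 symalg_scale.
Proof. exact: mul1r. Qed.
Fact symalg_scalerDr : right_distributive symalg_scale +%R.
Proof. by move=> a f h; apply: mulrDr. Qed.
Fact symalg_scalerDl f : {morph symalg_scale^~ f : a b / a + b}.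
Proof. by move=> a b; rewrite /symalg_scale cstD; apply: mulrDl. Qed.
HB.instance Definition _ := GRing.Zmodule_isLmodule.Build K symalg
  symalg_scalerA symalg_scale1r symalg_scalerDr symalg_scalerDl.

Fact symalg_scalerAl a (f h : symalg) : a *: (f * h) = a *: f * h.
Proof. exact: mulrA. Qed.
HB.instance Definition _ :=
  GRing.Lmodule_isLalgebra.Build K symalg symalg_scalerAl.
HB.instance Definition _ := GRing.Lalgebra_isComAlgebra.Build K symalg.

Definition sgen (v : V) : symalg := cls (SVar v).

Let cstE a : cls (SCst a) = a%:A.
Proof. by rewrite -[LHS](mulr1 (symalg_cst a)). Qed.

Lemma sgen_linear : linear sgen.
Proof.
move=> a u v; rewrite /sgen {2}/+%R {2}/*:%R /= /symalg_scale mulE addE.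
apply/cls_eq; apply: SC_trans (SC_varD _ _) _.
exact: SC_add (SC_varZ _ _) (SC_refl _).
Qed.

Lemma sym_ind (P : symalg -> Prop) :
    (forall a, P a%:A) -> (forall v, P (sgen v)) ->
    (forall f h, P f -> P h -> P (f + h)) ->
    (forall f h, P f -> P h -> P (f * h)) ->
  forall f, P f.
Proof.
move=> Pc Pv PD PM; elim/cls_ind; elim=> [v|a|x Px y Py|x Px y Py] //.
- exact: Pv.
- by rewrite cstE.
- by rewrite -addE; apply: PD.
- by rewrite -mulE; apply: PM.
Qed.

(* Universal property of the symmetric algebra. *)
Section Lift.
Variables (B : comAlgType K) (phi : V -> B).

Fixpoint seval (x : sexp) : B :=
  match x with
  | SVar v => phi v
  | SCst a => a%:A
  | SAdd x y => seval x + seval y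
  | SMul x y => seval x * seval y
  end.
Definition symlift (f : symalg) : B := seval (repr f).

Hypothesis lphi : linear phi.

Let seval_cong x y : scong x y -> seval x = seval y.
Proof.
elim=> //=.
- by move=> ? ? ? _ -> _ ->.
- by move=> ? ? ? ? _ -> _ ->.
- by move=> ? ? ? ? _ -> _ ->.
- by move=> *; rewrite addrA.
- by move=> *; rewrite addrC.
- by move=> *; rewrite scale0r add0r.
- by move=> *; rewrite !scaleN1r mulN1r addNr scale0r.
- by move=> *; rewrite mulrA.
- by move=> *; rewrite mulrC.
- by move=> *; rewrite scale1r mul1r.
- by move=> *; rewrite mulrDl.
- by move=> *; rewrite scalerDl.
- by move=> *; rewrite -scalerAl mul1r scalerA.
- by move=> *; rewrite (linD lphi).
- by move=> *; rewrite (linZ lphi) -scalerAl mul1r.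
Qed.

Let symliftE x : symlift (cls x) = seval x.
Proof. exact/seval_cong/repr_cls. Qed.

Lemma symlift_gen v : symlift (sgen v) = phi v.
Proof. exact: symliftE. Qed.
Lemma symlift_cst a : symlift a%:A = a%:A.
Proof. by rewrite -cstE symliftE. Qed.
Lemma symliftD f h : symlift (f + h) = symlift f + symlift h.
Proof.
elim/cls_ind: f => x; elim/cls_ind: h => y.
by rewrite {1}/+%R /= addE !symliftE.
Qed.
Lemma symliftM f h : symlift (f * h) = symlift f * symlift h.
Proof.
elim/cls_ind: f => x; elim/cls_ind: h => y.
by rewrite {1}/*%R /= mulE !symliftE.
Qed.
Lemma symlift_unique (F : {lrmorphism symalg -> B}) :
  (forall v, F (sgen v) = phi v) -> F =1 symlift.
Proof.
move=> Fv; elim/sym_ind=> [a|v|f h Ef Eh|f h Ef Eh].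
- by rewrite symlift_cst linearZ rmorph1.
- by rewrite symlift_gen.
- by rewrite symliftD rmorphD /= Ef Eh.
- by rewrite symliftM rmorphM /= Ef Eh.
Qed.
End Lift.

(* M is an S(V)-module through act. The Leibniz rule is built into the
   recursion on expressions; symder act d is meaningful when act is a module
   structure and d is linear, cf. the lemmas below. *)
Section Derivation.
Variables (M : lmodType K) (act : symalg -> M -> M) (d : V -> M).

Fixpoint dereval (x : sexp) : M :=
  match x with
  | SVar v => d v
  | SCst _ => 0
  | SAdd x y => dereval x + dereval y
  | SMul x y => act (\pi_({eq_quot scongb}) x) (dereval y)
                + act (\pi_({eq_quot scongb}) y) (dereval x)
  end.
Definition symder (f : symalg) : M := dereval (repr f).

Record is_action : Prop := IsAction {
  action_bilinear : bilinear_op act;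
  action1 : forall m, act 1 m = m;
  actionM : forall f h m, act (f * h) m = act f (act h m)
}.
Hypotheses (Hact : is_action) (ld : linear d).

Let act_lr f : linear (act f). Proof. by case: Hact => -[]. Qed.
Let act_ll m : linear (act^~ m). Proof. by case: Hact => -[]. Qed.
Let actDl f h m : act (f + h) m = act f m + act h m.
Proof. exact: linD (act_ll m) f h. Qed.
Let actDr f m n : act f (m + n) = act f m + act f n.
Proof. exact: linD (act_lr f) m n. Qed.
Let act_r0 f : act f 0 = 0. Proof. exact: lin0 (act_lr f). Qed.
Let act_cst a m : act a%:A m = a *: m.
Proof. by rewrite (linZ (act_ll m)) /= (action1 Hact). Qed.
Let clsD x y : cls (SAdd x y) = cls x + cls y.
Proof. by rewrite -addE. Qed.
Let clsM x y : cls (SMul x y) = cls x * cls y.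
Proof. by rewrite -mulE. Qed.

Let dereval_cong x y : scong x y -> dereval x = dereval y.
Proof.
rewrite -/cls; elim=> //=; rewrite -/cls.
- by move=> ? ? ? _ -> _ ->.
- by move=> ? ? ? ? _ -> _ ->.
- by move=> x0 x' y0 y' /cls_eq e -> /cls_eq e' ->; rewrite -/cls -!/(cls _) e e'.
- by move=> *; rewrite addrA.
- by move=> *; rewrite addrC.
- by move=> *; rewrite add0r.
- by move=> x0; rewrite -!/(cls _) act_r0 addr0 cstE act_cst scaleN1r addNr.
- move=> x0 y0 z0; rewrite -!/(cls _) !clsM !actDr -!(actionM Hact) -addrA.
  by rewrite ![_ * cls x0]mulrC ![_ * cls z0]mulrC.
- by move=> *; rewrite addrC.
- by move=> x0; rewrite -!/(cls _) act_r0 addr0 cstE act_cst scale1r.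
- by move=> x0 y0 z0; rewrite -!/(cls _) clsD actDl actDr addrACA.
- by move=> *; rewrite addr0.
- by move=> *; rewrite !act_r0 addr0.
- by move=> *; rewrite (linD ld).
- by move=> *; rewrite -!/(cls _) act_r0 addr0 cstE act_cst (linZ ld).
Qed.

Let symderE x : symder (cls x) = dereval x.
Proof. exact/dereval_cong/repr_cls. Qed.

Lemma symder_gen v : symder (sgen v) = d v.
Proof. exact: symderE. Qed.
Lemma symder_cst a : symder a%:A = 0.
Proof. by rewrite -cstE symderE. Qed.
Lemma symderD f h : symder (f + h) = symder f + symder h.
Proof. by elim/cls_ind: f => x; elim/cls_ind: h => y; rewrite -clsD !symderE. Qed.
Lemma symderM f h : symder (f * h) = act f (symder h) + act h (symder f).
Proof. by elim/cls_ind: f => x; elim/cls_ind: h => y; rewrite -clsM !symderE. Qed.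
Lemma symder_linear : linear symder.
Proof.
move=> a f h; rewrite symderD; congr (_ + _).
by rewrite -[a *: f]mulr_algl symderM symder_cst act_r0 addr0 act_cst.
Qed.
End Derivation.

End SymmetricAlgebra.

Notation "{ 'sym' V }" := (symalg V) (format "{ 'sym'  V }") : type_scope.

(* -------------------------------------------------------------------------- *)

(* The tensor product over K: formal linear combinations of pure tensors modulo
   the congruence generated by the vector space axioms and bilinearity. *)
Section TensorProduct.
Variables (K : fieldType) (U W : lmodType K).

Inductive texp : Type :=
| TPure of U & W
| TZero
| TAdd of texp & texp
| TScale of K & texp.

Inductive tcong : texp -> texp -> Prop :=
| TC_refl x : tcong x x
| TC_sym x y : tcong x y -> tcong y x
| TC_trans x y z : tcong x y -> tcong y z -> tcong x z
| TC_add x x' y y' : tcong x x' -> tcong y y' -> tcong (TAdd x y) (TAdd x' y')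
| TC_scale a x x' : tcong x x' -> tcong (TScale a x) (TScale a x')
| TC_addA x y z : tcong (TAdd x (TAdd y z)) (TAdd (TAdd x y) z)
| TC_addC x y : tcong (TAdd x y) (TAdd y x)
| TC_add0 x : tcong (TAdd TZero x) x
| TC_addN x : tcong (TAdd (TScale (-1) x) x) TZero
| TC_scaleA a b x : tcong (TScale a (TScale b x)) (TScale (a * b) x)
| TC_scale1 x : tcong (TScale 1 x) x
| TC_scaleDr a x y :
    tcong (TScale a (TAdd x y)) (TAdd (TScale a x) (TScale a y))
| TC_scaleDl a b x : tcong (TScale (a + b) x) (TAdd (TScale a x) (TScale b x))
| TC_pureDl u u' w : tcong (TPure (u + u') w) (TAdd (TPure u w) (TPure u' w))
| TC_pureDr u w w' : tcong (TPure u (w + w')) (TAdd (TPure u w) (TPure u w'))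
| TC_pureZl a u w : tcong (TPure (a *: u) w) (TScale a (TPure u w))
| TC_pureZr a u w : tcong (TPure u (a *: w)) (TScale a (TPure u w)).

HB.instance Definition _ := gen_eqMixin texp.
HB.instance Definition _ := gen_choiceMixin texp.

Definition tcongb : rel texp := fun x y => `[< tcong x y >].
Fact tcongb_refl : reflexive tcongb.
Proof. by move=> x; apply/asboolP/TC_refl. Qed.
Fact tcongb_sym : symmetric tcongb.
Proof. by move=> x y; apply/asboolP/asboolP => /TC_sym. Qed.
Fact tcongb_trans : transitive tcongb.
Proof. by move=> y x z /asboolP h /asboolP h'; apply/asboolP/(TC_trans h). Qed.
Canonical tcongb_equiv := EquivRel tcongb tcongb_refl tcongb_sym tcongb_trans.

Definition tensor : Type := {eq_quot tcongb}.
HB.instance Definition _ := Choice.on tensor.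

Let cls (x : texp) : tensor := \pi_({eq_quot tcongb}) x.

Let cls_eq x y : cls x = cls y <-> tcong x y.
Proof.
split=> [/eqmodP/asboolP //|h]; apply/eqmodP; exact/asboolP.
Qed.
Let cls_ind (P : tensor -> Prop) : (forall x, P (cls x)) -> forall f, P f.
Proof. by move=> h f; rewrite -[f]reprK; apply: h. Qed.
Let repr_cls x : tcong (repr (cls x)) x.
Proof. by apply/cls_eq; rewrite /cls reprK. Qed.

Definition tensor_zero : tensor := cls TZero.
Definition tensor_add (s t : tensor) : tensor := cls (TAdd (repr s) (repr t)).
Definition tensor_scale (a : K) (t : tensor) : tensor :=
  cls (TScale a (repr t)).
Definition tensor_opp (t : tensor) : tensor := tensor_scale (-1) t.

Let addE x y : tensor_add (cls x) (cls y) = cls (TAdd x y).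
Proof. by apply/cls_eq/TC_add; exact: repr_cls. Qed.
Let scaleE a x : tensor_scale a (cls x) = cls (TScale a x).
Proof. by apply/cls_eq/TC_scale; exact: repr_cls. Qed.

Fact tensor_addA : associative tensor_add.
Proof.
by elim/cls_ind=> x; elim/cls_ind=> y; elim/cls_ind=> z;
  rewrite !addE; apply/cls_eq/TC_addA.
Qed.
Fact tensor_addC : commutative tensor_add.
Proof.
by elim/cls_ind=> x; elim/cls_ind=> y; rewrite !addE; apply/cls_eq/TC_addC.
Qed.
Fact tensor_add0 : left_id tensor_zero tensor_add.
Proof. by elim/cls_ind=> x; rewrite addE; apply/cls_eq/TC_add0. Qed.
Fact tensor_addN : left_inverse tensor_zero tensor_opp tensor_add.
Proof.
by elim/cls_ind=> x; rewrite /tensor_opp scaleE addE; apply/cls_eq/TC_addN.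
Qed.
HB.instance Definition _ := GRing.isZmodule.Build tensor
  tensor_addA tensor_addC tensor_add0 tensor_addN.

Let addE' x y : cls x + cls y = cls (TAdd x y).
Proof. exact: addE. Qed.

Fact tensor_scalerA a b t :
  tensor_scale a (tensor_scale b t) = tensor_scale (a * b) t.
Proof. by elim/cls_ind: t => x; rewrite !scaleE; apply/cls_eq/TC_scaleA. Qed.
Fact tensor_scale1r : left_id 1 tensor_scale.
Proof. by elim/cls_ind=> x; rewrite scaleE; apply/cls_eq/TC_scale1. Qed.
Fact tensor_scalerDr : right_distributive tensor_scale +%R.
Proof.
move=> a; elim/cls_ind=> x; elim/cls_ind=> y.
by rewrite addE' !scaleE addE'; apply/cls_eq/TC_scaleDr.
Qed.
Fact tensor_scalerDl t : {morph tensor_scale^~ t : a b / a + b}.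
Proof.
by elim/cls_ind: t => x a b; rewrite !scaleE addE'; apply/cls_eq/TC_scaleDl.
Qed.
HB.instance Definition _ := GRing.Zmodule_isLmodule.Build K tensor
  tensor_scalerA tensor_scale1r tensor_scalerDr tensor_scalerDl.

Let scaleE' a x : a *: cls x = cls (TScale a x).
Proof. exact: scaleE. Qed.

Definition pure (u : U) (w : W) : tensor := cls (TPure u w).

Lemma pure_bilinear : bilinear_op pure.
Proof.
split=> [u a w w'|w a u u']; rewrite /pure scaleE' addE'; apply/cls_eq.
  apply: TC_trans (TC_pureDr _ _ _) _.
  exact: TC_add (TC_pureZr _ _ _) (TC_refl _).
apply: TC_trans (TC_pureDl _ _ _) _.
exact: TC_add (TC_pureZl _ _ _) (TC_refl _).
Qed.

Lemma tensor_ind (P : tensor -> Prop) :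
    (forall u w, P (pure u w)) -> P 0 ->
    (forall s t, P s -> P t -> P (s + t)) ->
    (forall a t, P t -> P (a *: t)) ->
  forall t, P t.
Proof.
move=> Pp P0 PD PZ; elim/cls_ind; elim=> [u w||x Px y Py|a x Px] //.
- exact: Pp.
- by rewrite -addE'; apply: PD.
- by rewrite -scaleE'; apply: PZ.
Qed.

(* Universal property of the tensor product: tlift b is meaningful when b is
   bilinear. *)
Section Lift.
Variables (M : lmodType K) (b : U -> W -> M).

Fixpoint teval (x : texp) : M :=
  match x with
  | TPure u w => b u w
  | TZero => 0
  | TAdd x y => teval x + teval y
  | TScale a x => a *: teval x
  end.
Definition tlift (t : tensor) : M := teval (repr t).

Hypothesis bb : bilinear_op b.

Let teval_cong x y : tcong x y -> teval x = teval y.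
Proof.
have [br bl] := bb; elim=> //=.
- by move=> ? ? ? _ -> _ ->.
- by move=> ? ? ? ? _ -> _ ->.
- by move=> ? ? ? _ ->.
- by move=> *; rewrite addrA.
- by move=> *; rewrite addrC.
- by move=> *; rewrite add0r.
- by move=> *; rewrite scaleN1r addNr.
- by move=> *; rewrite scalerA.
- by move=> *; rewrite scale1r.
- by move=> *; rewrite scalerDr.
- by move=> *; rewrite scalerDl.
- by move=> u u' w; rewrite (linD (bl w)).
- by move=> u w w'; rewrite (linD (br u)).
- by move=> a u w; rewrite (linZ (bl w)).
- by move=> a u w; rewrite (linZ (br u)).
Qed.

Let tliftE x : tlift (cls x) = teval x.
Proof. exact/teval_cong/repr_cls. Qed.

Lemma tlift_pure u w : tlift (pure u w) = b u w.
Proof. exact: tliftE. Qed.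
Lemma tlift_linear : linear tlift.
Proof.
move=> a; elim/cls_ind=> x; elim/cls_ind=> y.
by rewrite scaleE' addE' !tliftE.
Qed.
Lemma tlift_unique (F : tensor -> M) :
  linear F -> (forall u w, F (pure u w) = b u w) -> F =1 tlift.
Proof.
move=> lF Fb; elim/tensor_ind=> [u w||s t Es Et|a t Et].
- by rewrite tlift_pure.
- by rewrite (lin0 lF) (lin0 tlift_linear).
- by rewrite (linD lF) (linD tlift_linear) Es Et.
- by rewrite (linZ lF) (linZ tlift_linear) Et.
Qed.
End Lift.

End TensorProduct.

Notation "u ⊗ w" := (pure u w) (at level 40, left associativity) : ring_scope.

(* -------------------------------------------------------------------------- *)

Section PolynomialFunctions.
Variables (K : fieldType) (g : lmodType K) (br : g -> g -> g).

Local Notation S := {sym gLie br}.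

Definition Apoly : lmodType K := tensor S g.

Definition sbar (x : g) : S := sgen (bar br x).

(* The Lie-Poisson bracket: {-, v} is the derivation u |-> [u, v] for v in
   g_Lie, and {f, -} is the derivation v |-> {f, v}. *)
Definition lie_poisson_gen (f : S) (v : gLie br) : S :=
  symder *%R (fun u => sgen (lie_br u v)) f.
Definition lie_poisson (f h : S) : S := symder *%R (lie_poisson_gen f) h.

(* The S-module structure, f (h ⊗ y) = fh ⊗ y. *)
Definition poly_act (f : S) (t : Apoly) : Apoly :=
  tlift (fun h y => (f * h) ⊗ y) t.

(* {f, y}: the derivation in f extending u |-> 1 ⊗ [u, y]; the value on a
   monomial is given by poly_der_prod below. *)
Definition poly_der (f : S) (y : g) : Apoly :=
  symder poly_act (fun u => 1 ⊗ lie_act u y) f.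

(* {f, h ⊗ y} *)
Definition poly_der_ext (f : S) (t : Apoly) : Apoly :=
  tlift (fun h y => lie_poisson f h ⊗ y + poly_act h (poly_der f y)) t.

(* f ⊗ x |-> f xbar *)
Definition poly_mu (t : Apoly) : S := tlift (fun f x => f * sbar x) t.

Definition poly_star (t u : Apoly) : Apoly := poly_act (poly_mu t) u.
Definition poly_bracket (t u : Apoly) : Apoly := poly_der_ext (poly_mu t) u.
Definition poly_iota (x : g) : Apoly := 1 ⊗ x.

Lemma sbar_linear : linear sbar.
Proof. by move=> a x y; rewrite /sbar bar_linear sgen_linear. Qed.

Lemma mul_bilinear (B : comAlgType K) : bilinear_op ( *%R : B -> B -> B).
Proof.
split=> f a h k; first by rewrite mulrDr scalerAr.
by rewrite /= mulrDl scalerAl.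
Qed.

Lemma pure_mul_bilinear f : bilinear_op (fun (h : S) (y : g) => (f * h) ⊗ y).
Proof.
have [pr pl] := @pure_bilinear K S g; split=> [h|y] a u v /=.
  exact: pr.
by rewrite (mul_bilinear S).1 -pl.
Qed.

Lemma poly_act_pure f h y : poly_act f (h ⊗ y) = (f * h) ⊗ y.
Proof. by rewrite /poly_act tlift_pure //; apply: pure_mul_bilinear. Qed.

Lemma poly_act_bilinear : bilinear_op poly_act.
Proof.
have lr f : linear (poly_act f) by apply/tlift_linear/pure_mul_bilinear.
split=> // t a f h /=; elim/tensor_ind: t => [k y||s t Es Et|b t Et].
- by rewrite !poly_act_pure (mul_bilinear S).2 /= (pure_bilinear S g).2.
- by rewrite !(lin0 (lr _)) scaler0 addr0.
- by rewrite !(linD (lr _)) Es Et scalerDr addrACA.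
- by rewrite !(linZ (lr _)) Et scalerDr !scalerA mulrC.
Qed.

Lemma poly_action : is_action poly_act.
Proof.
split; first exact: poly_act_bilinear.
- elim/tensor_ind=> [k y||s t Es Et|b t Et].
  + by rewrite poly_act_pure mul1r.
  + by rewrite (lin0 (poly_act_bilinear.1 _)).
  + by rewrite (linD (poly_act_bilinear.1 _)) Es Et.
  + by rewrite (linZ (poly_act_bilinear.1 _)) Et.
- move=> f h; elim/tensor_ind=> [k y||s t Es Et|b t Et].
  + by rewrite !poly_act_pure mulrA.
  + by rewrite !(lin0 (poly_act_bilinear.1 _)).
  + by rewrite !(linD (poly_act_bilinear.1 _)) Es Et.
  + by rewrite !(linZ (poly_act_bilinear.1 _)) Et.
Qed.

Lemma mul_action (V : lmodType K) : is_action ( *%R : {sym V} -> _ -> _).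
Proof.
split; [exact: mul_bilinear | exact: mul1r |].
by move=> f h k; rewrite mulrA.
Qed.

Lemma poly_mu_pure f x : poly_mu (f ⊗ x) = f * sbar x.
Proof.
rewrite /poly_mu tlift_pure //; split=> [h|y] a u v /=.
  by rewrite sbar_linear (mul_bilinear S).1.
by rewrite (mul_bilinear S).2.
Qed.

Lemma poly_star_pure f x h y :
  poly_star (f ⊗ x) (h ⊗ y) = (f * sbar x * h) ⊗ y.
Proof. by rewrite /poly_star poly_mu_pure poly_act_pure. Qed.

Hypothesis Hg : is_loday br.

Let lr_br := (lie_br_bilinear Hg).1.
Let ll_br := (lie_br_bilinear Hg).2.

Let gen_linear v : linear (fun u => sgen (lie_br u v) : S).
Proof. by move=> a u w; rewrite ll_br sgen_linear. Qed.

Lemma lie_poisson_gen_linear f : linear (lie_poisson_gen f).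
Proof.
pose D v := symderM (mul_action _) (gen_linear v).
pose E v := symderD (mul_action _) (gen_linear v).
move=> a u v; rewrite /lie_poisson_gen.
elim/sym_ind: f => [b|w|f h Ef Eh|f h Ef Eh].
- by rewrite !(symder_cst (mul_action _) (gen_linear _)) scaler0 addr0.
- by rewrite !(symder_gen (mul_action _) (gen_linear _)) lr_br sgen_linear.
- by rewrite !E Ef Eh scalerDr addrACA.
- rewrite !D Ef Eh !mulrDr scalerDr -!scalerAr.
  by rewrite addrACA.
Qed.

Lemma lie_poisson_linear f : linear (lie_poisson f).
Proof. exact/symder_linear/lie_poisson_gen_linear/mul_action. Qed.

Lemma lie_poisson_gens u v :
  lie_poisson (sgen u) (sgen v) = sgen (lie_br u v).
Proof.
rewrite /lie_poisson (symder_gen (mul_action _) (lie_poisson_gen_linear _)).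
exact: (symder_gen (mul_action _) (gen_linear _)).
Qed.

Lemma lie_poisson_sbar x y : lie_poisson (sbar x) (sbar y) = sbar (br x y).
Proof. by rewrite lie_poisson_gens lie_br_bar. Qed.

Lemma lie_poisson_derr f h k :
  lie_poisson f (h * k) = lie_poisson f h * k + h * lie_poisson f k.
Proof.
rewrite /lie_poisson (symderM (mul_action _) (lie_poisson_gen_linear _)).
by rewrite addrC [k * _]mulrC.
Qed.

Let lp_genM f h v : lie_poisson_gen (f * h) v =
  f * lie_poisson_gen h v + h * lie_poisson_gen f v.
Proof. exact: (symderM (mul_action _) (gen_linear _)). Qed.
Let lp_cst f a : lie_poisson f a%:A = 0.
Proof. exact: (symder_cst (mul_action _) (lie_poisson_gen_linear _)). Qed.
Let lp_gen f v : lie_poisson f (sgen v) = lie_poisson_gen f v.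
Proof. exact: (symder_gen (mul_action _) (lie_poisson_gen_linear _)). Qed.
Let lpDr f h k : lie_poisson f (h + k) = lie_poisson f h + lie_poisson f k.
Proof. exact: linD (lie_poisson_linear f) h k. Qed.

Let lpDl f h k : lie_poisson (f + h) k = lie_poisson f k + lie_poisson h k.
Proof.
elim/sym_ind: k => [a|v|k l Ek El|k l Ek El].
- by rewrite !lp_cst addr0.
- by rewrite !lp_gen; apply: (symderD (mul_action _) (gen_linear _)).
- by rewrite !lpDr Ek El addrACA.
- by rewrite !lie_poisson_derr Ek El; ring.
Qed.

Lemma lie_poisson_skew f h : lie_poisson f h = - lie_poisson h f.
Proof.
have cstl a k : lie_poisson a%:A k = 0.
  elim/sym_ind: k => [b|v|k l Ek El|k l Ek El].
  - exact: lp_cst.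
  - by rewrite lp_gen; apply: (symder_cst (mul_action _) (gen_linear _)).
  - by rewrite lpDr Ek El addr0.
  - by rewrite lie_poisson_derr Ek El mul0r mulr0 addr0.
elim/sym_ind: h f => [b|v|h k Eh Ek|h k Eh Ek] f.
- by rewrite lp_cst cstl oppr0.
- elim/sym_ind: f => [a|u|f k Ef Ek|f k Ef Ek].
  + by rewrite lp_cst cstl oppr0.
  + by rewrite !lie_poisson_gens lie_br_skew // (linN (@sgen_linear _ _)).
  + by rewrite lpDl lpDr opprD Ef Ek.
  + rewrite lie_poisson_derr lp_gen lp_genM -!lp_gen Ef Ek; ring.
- by rewrite lpDr lpDl Eh Ek opprD.
- rewrite lie_poisson_derr Eh Ek; apply/eqP; rewrite -addr_eq0.
  suff -> : lie_poisson (h * k) f = h * lie_poisson k f + k * lie_poisson h f.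
    by apply/eqP; ring.
  elim/sym_ind: f => [a|v|f l Ef El|f l Ef El].
  + by rewrite !lp_cst !mulr0 addr0.
  + by rewrite !lp_gen lp_genM.
  + by rewrite !lpDr Ef El; ring.
  + by rewrite !lie_poisson_derr Ef El; ring.
Qed.

Lemma lie_poisson_derl f h k :
  lie_poisson (f * h) k = f * lie_poisson h k + h * lie_poisson f k.
Proof.
rewrite lie_poisson_skew lie_poisson_derr.
rewrite (lie_poisson_skew k f) (lie_poisson_skew k h); ring.
Qed.

Lemma lie_poisson_bilinear : bilinear_op lie_poisson.
Proof.
split=> [|k a f h]; first exact: lie_poisson_linear.
rewrite /= lie_poisson_skew lie_poisson_linear [in RHS]lie_poisson_skew.
by rewrite (lie_poisson_skew h) opprD scalerN.
Qed.

Lemma lie_poisson_jacobi f h k :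
  lie_poisson f (lie_poisson h k) =
  lie_poisson (lie_poisson f h) k + lie_poisson h (lie_poisson f k).
Proof.
have l0 x : lie_poisson 0 x = 0 by apply: (lin0 (lie_poisson_bilinear.2 x)).
have r0 x : lie_poisson x 0 = 0 by apply: (lin0 (lie_poisson_bilinear.1 x)).
have cstl a x : lie_poisson a%:A x = 0.
  by rewrite lie_poisson_skew lp_cst oppr0.
elim/sym_ind: k f h => [c|w|k k' Ek Ek'|k k' Ek Ek'] f h.
- by rewrite !lp_cst !r0 addr0.
- elim/sym_ind: h f => [b|v|h h' Eh Eh'|h h' Eh Eh'] f.
  + by rewrite !(cstl, lp_cst, l0, r0) addr0.
  + elim/sym_ind: f => [a|u|f f' Ef Ef'|f f' Ef Ef'].
    * by rewrite !(cstl, lp_cst, l0, r0) addr0.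
    * by rewrite !lie_poisson_gens lie_br_jacobi // (linD (@sgen_linear _ _)).
    * by rewrite !(lpDl, lpDr) Ef Ef'; ring.
    * rewrite !(lpDl, lpDr, lie_poisson_derl, lie_poisson_derr) Ef Ef'.
      rewrite (lie_poisson_skew (sgen v) f) (lie_poisson_skew (sgen v) f').
      ring.
  + by rewrite !(lpDl, lpDr) Eh Eh'; ring.
  + by rewrite !(lpDl, lpDr, lie_poisson_derl, lie_poisson_derr) Eh Eh'; ring.
- by rewrite !(lpDl, lpDr) Ek Ek'; ring.
- by rewrite !(lpDl, lpDr, lie_poisson_derl, lie_poisson_derr) Ek Ek'; ring.
Qed.

Lemma lie_poisson_unique (pb : S -> S -> S) : bilinear_op pb ->
    (forall f h k, pb (f * h) k = f * pb h k + h * pb f k) ->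
    (forall f h k, pb f (h * k) = pb f h * k + h * pb f k) ->
    (forall x y, pb (sbar x) (sbar y) = sbar (br x y)) ->
  pb =2 lie_poisson.
Proof.
move=> [pr pl] Ml Mr Eg.
have pl1 k : pb 1 k = 0.
  have := Ml 1 1 k; rewrite !mul1r => /eqP.
  by rewrite -subr_eq subrr eq_sym => /eqP.
have pr1 f : pb f 1 = 0.
  have := Mr f 1 1; rewrite !(mul1r, mulr1) => /eqP.
  by rewrite -subr_eq subrr eq_sym => /eqP.
move=> f h; elim/sym_ind: h f => [b|v|h h' Eh Eh'|h h' Eh Eh'] f.
- by rewrite (linZ (pr f)) pr1 lp_cst scaler0.
- elim/sym_ind: f => [a|u|f f' Ef Ef'|f f' Ef Ef'].
  + by rewrite (linZ (pl _)) /= pl1 lie_poisson_skew lp_cst scaler0 oppr0.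
  + by elim/bar_ind: u => x; elim/bar_ind: v => y; rewrite Eg lie_poisson_sbar.
  + by rewrite (linD (pl _)) /= Ef Ef' lpDl.
  + by rewrite Ml Ef Ef' lie_poisson_derl.
- by rewrite (linD (pr _)) Eh Eh' lpDr.
- by rewrite Mr Eh Eh' lie_poisson_derr.
Qed.

Let der_linear y : linear (fun u : gLie br => (1 : S) ⊗ lie_act u y : Apoly).
Proof.
move=> a u v; rewrite (lie_act_bilinear Hg).2 /=.
exact: (pure_bilinear S g).1.
Qed.

Lemma poly_der_linear y : linear (poly_der ^~ y).
Proof. exact/symder_linear/der_linear/poly_action. Qed.

Lemma poly_der1 y : poly_der 1 y = 0.
Proof.
by rewrite -(scale1r 1); apply: (symder_cst poly_action (der_linear y)).
Qed.

Lemma poly_der_sbar x y : poly_der (sbar x) y = 1 ⊗ br x y.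
Proof.
by rewrite /poly_der (symder_gen poly_action (der_linear y)) lie_act_bar.
Qed.

Lemma poly_derM f h y : poly_der (f * h) y =
  poly_act f (poly_der h y) + poly_act h (poly_der f y).
Proof. exact: (symderM poly_action (der_linear y)). Qed.

Lemma poly_der_prod n (x : 'I_n -> g) y :
  poly_der (\prod_i sbar (x i)) y =
  \sum_i (\prod_(j | j != i) sbar (x j)) ⊗ br (x i) y.
Proof.
elim: n x => [|n IH] x; first by rewrite !big_ord0 poly_der1.
rewrite !big_ord_recl poly_derM IH addrC poly_der_sbar poly_act_pure mulr1.
congr (_ + _).
  by rewrite [in RHS]big_mkcond big_ord_recl /= mul1r.
rewrite (lin_sum (poly_act_bilinear.1 _)); apply: eq_bigr => i _.
rewrite poly_act_pure; congr (_ ⊗ _).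
rewrite [in RHS]big_mkcond big_ord_recl /=; congr (_ * _).
by rewrite big_mkcond; apply: eq_bigr => j _.
Qed.

Lemma poly_der_bilinear : bilinear_op poly_der.
Proof.
split=> [f a y z|]; last exact: poly_der_linear.
have aD := linD (poly_act_bilinear.1 _); have aZ := linZ (poly_act_bilinear.1 _).
elim/sym_ind: f => [b|u|f h Ef Eh|f h Ef Eh].
- by rewrite !(linZ (poly_der_linear _)) /= !poly_der1 !scaler0 addr0.
- elim/bar_ind: u => x; rewrite !poly_der_sbar.
  by rewrite (loday_bilinear Hg).1 (pure_bilinear S g).1.
- by rewrite !(linD (poly_der_linear _)) /= Ef Eh scalerDr addrACA.
- by rewrite !poly_derM Ef Eh !aD !aZ scalerDr addrACA.
Qed.

Lemma poly_der_ext_pure f h y :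
  poly_der_ext f (h ⊗ y) = lie_poisson f h ⊗ y + poly_act h (poly_der f y).
Proof.
rewrite /poly_der_ext tlift_pure //; split=> [k|z] a u v /=.
  rewrite (pure_bilinear S g).1 poly_der_bilinear.1 poly_act_bilinear.1.
  by rewrite scalerDr addrACA.
rewrite lie_poisson_linear (pure_bilinear S g).2 poly_act_bilinear.2 /=.
by rewrite scalerDr addrACA.
Qed.

Lemma poly_bracket_pure f x h y : poly_bracket (f ⊗ x) (h ⊗ y) =
  lie_poisson (f * sbar x) h ⊗ y + poly_act h (poly_der (f * sbar x) y).
Proof. by rewrite /poly_bracket poly_mu_pure poly_der_ext_pure. Qed.

End PolynomialFunctions.

Arguments ann {K g} br z.
Arguments bar {K g} br x.
Arguments sbar {K g} br x.
Arguments lie_poisson {K g} br f h.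
Arguments poly_act {K g} br f t.
Arguments poly_der {K g} br f y.
Arguments poly_der_ext {K g} br f t.
Arguments poly_mu {K g} br t.
Arguments poly_star {K g} br t u.
Arguments poly_bracket {K g} br t u.
Arguments poly_iota {K g} br x.

(* Main.v *)
Require Import Defs.
From HB Require Import structures.
From mathcomp Require Import all_boot all_algebra.
From mathcomp Require Import boolp.

Set Implicit Arguments.
Unset Strict Implicit.
Unset Printing Implicit Defensive.

Import GRing.Theory.
Local Open Scope ring_scope.

(** Write S for S(g_Lie) and A for S ⊗ g, and let mu : A -> S be the S-linear
    map f ⊗ x |-> f xbar. Both operations of A factor through mu in their left
    argument: t * u = mu(t) u, and {t, u} = D_{mu(t)} u where D_f is the map
    {f, -}. The dual-prePoisson axioms of A therefore reduce to identities
    about the operators D_f: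
    - D_{fh} = f D_h + h D_f                        (poly_der_extMl),
    - D_f (h t) = {f, h} t + h (D_f t)              (poly_der_extMr),
    - mu (D_f t) = {f, mu t}                        (poly_mu_der_ext),
    - [D_f, D_h] = D_{{f, h}}                       (poly_der_ext_comm),
    together with S being a commutative Poisson algebra. The first two hold
    because D is assembled from derivations. The last two compare derivations,
    so they only have to be verified on generators: there they say that
    x |-> xbar preserves brackets, and that g satisfies the Leibniz identity.

    For the universal property, let phi : g -> P be a Loday morphism. By the
    perm identity the left multiplications by phi x commute with each other,
    and by axiom (iii) they vanish on g^ann; so they make P a module over S
    (symact_action). Then phihat (f ⊗ y) = f . phi y is forced, because A is
    generated from iota g by left multiplications by iota g (star_hom_ext).
    It preserves * since mu(t) . p = phihat(t) * p (ext_act_mu). For the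
    bracket, p |-> {phi x, p} depends only on xbar, hence extends to a
    derivation f |-> E_f in f; then E_{mu(t)} p = {phihat t, p} (ext_der_mu)
    and phihat o D_f = E_f o phihat (ext_hom_der_ext), which combine into
    phihat {t, u} = {phihat t, phihat u}.

    Injectivity of iota comes from the universal property itself: the Loday
    algebra g with the zero product is dual-prePoisson, and the extension of
    the identity of g is a left inverse of iota. *)

(** * Bilinear operations, tensor products and module structures *)

Section LinearOperators.
Variables (K : fieldType).

Section Bilinear.
Variables (U V W : lmodType K) (b : U -> V -> W).
Hypothesis bb : bilinear_op b.

Lemma bilDl u u' v : b (u + u') v = b u v + b u' v.
Proof. exact: linD (bb.2 v) u u'. Qed.
Lemma bilDr u v v' : b u (v + v') = b u v + b u v'.
Proof. exact: linD (bb.1 u) v v'. Qed.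
Lemma bilZl a u v : b (a *: u) v = a *: b u v.
Proof. exact: linZ (bb.2 v) a u. Qed.
Lemma bilZr a u v : b u (a *: v) = a *: b u v.
Proof. exact: linZ (bb.1 u) a v. Qed.
Lemma bilNl u v : b (- u) v = - b u v.
Proof. exact: linN (bb.2 v) u. Qed.
Lemma bil0l v : b 0 v = 0.
Proof. exact: lin0 (bb.2 v). Qed.
Lemma bil0r u : b u 0 = 0.
Proof. exact: lin0 (bb.1 u). Qed.
End Bilinear.

Lemma tensor_linear_ext (U W M : lmodType K) (F G : tensor U W -> M) :
  linear F -> linear G -> (forall u w, F (u ⊗ w) = G (u ⊗ w)) -> F =1 G.
Proof.
move=> lF lG FG; elim/tensor_ind=> [u w||s t Es Et|a t Et]; first exact: FG.
- by rewrite (lin0 lF) (lin0 lG).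
- by rewrite (linD lF) (linD lG) Es Et.
- by rewrite (linZ lF) (linZ lG) Et.
Qed.

Lemma action_cst (V M : lmodType K) (act : {sym V} -> M -> M) a m :
  is_action act -> act a%:A m = a *: m.
Proof. by case=> actB act1 _; rewrite (bilZl actB) act1. Qed.

End LinearOperators.

(** * Modules over a symmetric algebra from commuting operators *)

Section CommutingOperators.
Variables (K : fieldType) (V M : lmodType K) (op : V -> M -> M).

Fixpoint opeval (x : sexp V) (m : M) : M :=
  match x with
  | SVar v => op v m
  | SCst a => a *: m
  | SAdd x y => opeval x m + opeval y m
  | SMul x y => opeval x (opeval y m)
  end.

(** The universal property of {sym V} only concerns commutative target algebras,
    whereas the operators op v live in the noncommutative algebra End M; so the
    evaluation is carried out on expressions, and commutativity is recovered
    for the operators in its image by opevalC. *)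
Definition symact (f : {sym V}) : M -> M := opeval (repr f).

Hypotheses (opB : bilinear_op op).
Hypothesis opC : forall u v m, op u (op v m) = op v (op u m).

Lemma opeval_linear x : linear (opeval x).
Proof.
elim: x => [v|b|x lx y ly|x lx y ly] a m n /=.
- exact: opB.1.
- by rewrite scalerDr !scalerA mulrC.
- by rewrite lx ly scalerDr addrACA.
- by rewrite ly lx.
Qed.

Lemma op_opevalC u x m : op u (opeval x m) = opeval x (op u m).
Proof.
elim: x m => [v|b|x Ex y Ey|x Ex y Ey] m /=.
- exact: opC.
- exact: bilZr.
- by rewrite (bilDr opB) Ex Ey.
- by rewrite Ex Ey.
Qed.

Lemma opevalC x y m : opeval x (opeval y m) = opeval y (opeval x m).
Proof.
elim: x m => [v|b|x Ex z Ez|x Ex z Ez] m /=.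
- exact: op_opevalC.
- by rewrite (linZ (opeval_linear y)).
- by rewrite Ex Ez (linD (opeval_linear y)).
- by rewrite Ez Ex.
Qed.

Lemma opeval_cong x y : scong x y -> opeval x =1 opeval y.
Proof.
elim=> //=.
- by move=> ? ? _ E m /=; rewrite E.
- by move=> ? ? ? _ E _ F m /=; rewrite E F.
- by move=> ? ? ? ? _ E _ F m /=; rewrite E F.
- by move=> ? ? ? ? _ E _ F m /=; rewrite F E.
- by move=> * m /=; rewrite addrA.
- by move=> * m /=; rewrite addrC.
- by move=> * m /=; rewrite scale0r add0r.
- by move=> * m /=; rewrite scaleN1r addNr scale0r.
- by move=> * m /=; rewrite opevalC.
- by move=> * m /=; rewrite scale1r.
- by move=> a b m /=; rewrite scalerDl.
- by move=> a b m /=; rewrite scalerA.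
- by move=> u v m /=; rewrite (bilDl opB).
- by move=> a v m /=; rewrite (bilZl opB).
Qed.

Local Notation cls x := (\pi_({eq_quot (@scongb K V)})%qT x : {sym V}).

Lemma symact_class x m : symact (cls x) m = opeval x m.
Proof.
apply: opeval_cong; apply/asboolP.
by have /eqmodP := reprK (cls x).
Qed.

Lemma symact_gen v m : symact (sgen v) m = op v m.
Proof. exact: (symact_class (SVar v)). Qed.

Lemma symact_action : is_action symact.
Proof.
have actM f h m : symact (f * h) m = symact f (symact h m).
  exact: (symact_class (SMul (repr f) (repr h))).
split=> //; last by move=> m; rewrite (symact_class (SCst V 1)) /= scale1r.
split=> [f|m a f h]; first exact: opeval_linear.
rewrite /= [LHS](symact_class (SAdd (repr (a *: f)) (repr h))) /=.
congr (_ + _); rewrite -[LHS]/(symact (symalg_cst V a * f) m) actM.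
exact: (symact_class (SCst V a)).
Qed.

End CommutingOperators.

(** * The dual-prePoisson structure of S(g_Lie) ⊗ g *)

Section PolynomialAlgebra.
Variables (K : fieldType) (g : lmodType K) (br : g -> g -> g).
Hypothesis Hg : is_loday br.

Local Notation S := {sym gLie br}.
Local Notation A := (Apoly br).

Let pB := @pure_bilinear K S g.
Let aB : bilinear_op (poly_act br) := poly_act_bilinear br.
Let dB := poly_der_bilinear Hg.
Let lB := lie_poisson_bilinear Hg.
Let actM f h t : poly_act br (f * h) t = poly_act br f (poly_act br h t).
Proof. exact: (actionM (poly_action br)). Qed.

Lemma poly_mu_linear : linear (poly_mu br).
Proof.
apply: tlift_linear; split=> [f|y] a u v /=.
  by rewrite sbar_linear (mul_bilinear _).1.
by rewrite (mul_bilinear _).2.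
Qed.

Lemma poly_mu_act f t : poly_mu br (poly_act br f t) = f * poly_mu br t.
Proof.
move: t; apply: tensor_linear_ext => [a s t|a s t|h y].
- by rewrite aB.1 poly_mu_linear.
- by rewrite poly_mu_linear (mul_bilinear _).1.
- by rewrite poly_act_pure !poly_mu_pure mulrA.
Qed.

Lemma poly_der_ext_bilinear : bilinear_op (poly_der_ext br).
Proof.
have lr f : linear (poly_der_ext br f).
  apply: tlift_linear; split=> [h|y] a u v /=.
    rewrite pB.1 dB.1 aB.1 scalerDr; exact: addrACA.
  rewrite lB.1 pB.2 aB.2 /= scalerDr; exact: addrACA.
split=> // t a f h /=; move: t.
apply: tensor_linear_ext => [b s t|b s t|k y].
- exact: lr.
- by rewrite !lr !scalerDr !scalerA [a * b]mulrC addrACA.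
- rewrite !poly_der_ext_pure // lB.2 /= pB.2 /= dB.2 /= aB.1 scalerDr.
  exact: addrACA.
Qed.
Let DB := poly_der_ext_bilinear.

Lemma lie_poisson_one f : lie_poisson br f 1 = 0.
Proof.
have := lie_poisson_derr Hg f 1 1; rewrite !mulr1 mul1r => /eqP.
by rewrite -subr_eq subrr eq_sym => /eqP.
Qed.

Lemma poly_der_ext_gen f y : poly_der_ext br f (1 ⊗ y) = poly_der br f y.
Proof.
by rewrite poly_der_ext_pure // lie_poisson_one (bil0l pB) add0r
  (action1 (poly_action br)).
Qed.

Lemma poly_der_ext_cst a t : poly_der_ext br a%:A t = 0.
Proof.
move: t; apply: tensor_linear_ext => [b s t|b s t|k y].
- exact: DB.1.
- by rewrite scaler0 addr0.
- rewrite (bilZl DB) poly_der_ext_pure // poly_der1 // lie_poisson_skew //.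
  by rewrite lie_poisson_one oppr0 (bil0l pB) (bil0r aB) addr0 scaler0.
Qed.

Lemma poly_der_extMl f h t : poly_der_ext br (f * h) t =
  poly_act br f (poly_der_ext br h t) + poly_act br h (poly_der_ext br f t).
Proof.
move: t; apply: tensor_linear_ext => [a s t|a s t|k y].
- exact: DB.1.
- by rewrite !DB.1 !aB.1 scalerDr; exact: addrACA.
- rewrite !poly_der_ext_pure // poly_derM // lie_poisson_derl //.
  rewrite !(bilDr aB) (bilDl pB) !poly_act_pure -!actM.
  by rewrite [f * k]mulrC [h * k]mulrC; exact: addrACA.
Qed.

Lemma poly_der_extMr f h t : poly_der_ext br f (poly_act br h t) =
  poly_act br (lie_poisson br f h) t + poly_act br h (poly_der_ext br f t).
Proof.
move: t; apply: tensor_linear_ext => [a s t|a s t|k y].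
- by rewrite aB.1 DB.1.
- by rewrite DB.1 !aB.1 scalerDr; exact: addrACA.
- rewrite poly_act_pure !poly_der_ext_pure // lie_poisson_derr //.
  by rewrite (bilDr aB) (bilDl pB) !poly_act_pure -!actM addrA.
Qed.

(** On f = xbar and t = 1 ⊗ y this is the fact that bar is a Loday morphism;
    both sides are derivations in f, and in t they obey the same Leibniz rule
    over {f, -}. *)
Lemma poly_mu_der_ext f t :
  poly_mu br (poly_der_ext br f t) = lie_poisson br f (poly_mu br t).
Proof.
have mu_der y : poly_mu br (poly_der br f y) = lie_poisson br f (sbar br y).
  elim/sym_ind: f => [a|u|f h Ef Eh|f h Ef Eh].
  - rewrite (bilZl dB) poly_der1 // (bilZl lB) lie_poisson_skew //.
    by rewrite lie_poisson_one oppr0 !scaler0 (lin0 poly_mu_linear).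
  - elim/bar_ind: u => x; rewrite -[sgen _]/(sbar br x) poly_der_sbar //.
    by rewrite poly_mu_pure mul1r lie_poisson_sbar.
  - by rewrite (bilDl dB) (bilDl lB) (linD poly_mu_linear) Ef Eh.
  - rewrite poly_derM // (linD poly_mu_linear) !poly_mu_act Ef Eh.
    by rewrite lie_poisson_derl.
move: t; apply: tensor_linear_ext => [a s t|a s t|k y].
- by rewrite DB.1 poly_mu_linear.
- by rewrite poly_mu_linear lB.1.
- rewrite poly_der_ext_pure // (linD poly_mu_linear) poly_mu_act mu_der.
  by rewrite !poly_mu_pure lie_poisson_derr.
Qed.

(** The Leibniz identity of A in operator form. In t, both sides obey the same
    Leibniz rule by the Jacobi identity of S, which reduces to t = 1 ⊗ y. There
    the identity is antisymmetric in (f, h), and for fixed h the set of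
    f satisfying it is a subalgebra of S; applying this to f, and then to h
    after exchanging the two, leaves the case of two generators, which is the
    Leibniz identity of g. *)
Lemma poly_der_ext_comm f h t :
  poly_der_ext br f (poly_der_ext br h t) =
  poly_der_ext br (lie_poisson br f h) t +
  poly_der_ext br h (poly_der_ext br f t).
Proof.
pose C k l := forall y, poly_der_ext br k (poly_der_ext br l (1 ⊗ y)) =
  poly_der_ext br (lie_poisson br k l) (1 ⊗ y) +
  poly_der_ext br l (poly_der_ext br k (1 ⊗ y)).
have Csym k l : C k l -> C l k.
  by move=> Ckl y; rewrite Ckl (lie_poisson_skew Hg l) (bilNl DB) addKr.
have Cind l : (forall v, C (sgen v) l) -> forall k, C k l.
  move=> Cgen; elim/sym_ind=> [a|//|k k' Ck Ck'|k k' Ck Ck'] y.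
  - rewrite !poly_der_ext_cst (bil0r DB) addr0 (bilZl lB) lie_poisson_skew //.
    by rewrite lie_poisson_one oppr0 scaler0 (bil0l DB).
  - by rewrite (bilDl lB) !(bilDl DB) (bilDr DB) Ck Ck'; exact: addrACA.
  - rewrite lie_poisson_derl // (bilDl DB) !poly_der_extMl (bilDr DB).
    rewrite !poly_der_extMr Ck Ck' !(bilDr aB).
    rewrite (lie_poisson_skew Hg l) (lie_poisson_skew Hg l k') !(bilNl aB).
    (* The cross terms {k, l} D_k' and {k', l} D_k cancel by antisymmetry of
       the Poisson bracket. *)
    have cancel (a b c d p q : A) :
        a + c + (b + d) = a + p + (b + q) + (- q + c + (- p + d)).
      rewrite (addrACA a p) (addrACA (- q)) -opprD [q + p]addrC.
      by rewrite -[RHS]addrA addNKr; exact: addrACA.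
    exact: cancel.
have C1 k l : C k l.
  move: k; apply: (Cind) => v; apply: (Csym); move: l; apply: (Cind) => w y.
  elim/bar_ind: v => x; elim/bar_ind: w => z.
  rewrite -[sgen (bar br x)]/(sbar br x) -[sgen (bar br z)]/(sbar br z).
  rewrite lie_poisson_sbar // !poly_der_ext_gen !poly_der_sbar //.
  rewrite !poly_der_ext_gen !poly_der_sbar //.
  by rewrite (loday_leibniz Hg) (bilDr pB).
move: t; apply: tensor_linear_ext => [a s t|a s t|k y].
- by rewrite !DB.1.
- by rewrite !DB.1 scalerDr; exact: addrACA.
- (* The Leibniz rule in k on both sides, matched by the Jacobi identity. *)
  have -> : k ⊗ y = poly_act br k (1 ⊗ y) by rewrite poly_act_pure mulr1.
  rewrite !poly_der_extMr !(bilDr DB) !poly_der_extMr C1.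
  rewrite lie_poisson_jacobi // (bilDl aB) (bilDr aB) -!addrA; congr (_ + _).
  rewrite [RHS]addrCA; congr (_ + _).
  rewrite [LHS]addrCA [RHS]addrCA; congr (_ + _).
  exact: addrCA.
Qed.

Lemma poly_dual_prePoisson :
  is_dual_prePoisson (poly_star br) (poly_bracket br).
Proof.
have muM t u : poly_mu br (poly_star br t u) = poly_mu br t * poly_mu br u.
  exact: poly_mu_act.
have muB t u : poly_mu br (poly_bracket br t u) =
    lie_poisson br (poly_mu br t) (poly_mu br u).
  exact: poly_mu_der_ext.
split; [split | split | | |] => //.
- split=> [t|u a s t]; first exact: aB.1.
  by rewrite /poly_star poly_mu_linear aB.2.
- by move=> s t u; rewrite /poly_star -actM poly_mu_act.
- by move=> s t u; rewrite /poly_star !poly_mu_act mulrC.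
- split=> [t|u a s t]; first exact: DB.1.
  by rewrite /poly_bracket poly_mu_linear DB.2.
- move=> s t u; rewrite {1 2 4 5}/poly_bracket poly_der_ext_comm.
  by rewrite /poly_bracket -muB.
- by move=> s t u; rewrite {2}/poly_star muB; exact: poly_der_extMr.
- by move=> s t u; rewrite {1}/poly_bracket muM; exact: poly_der_extMl.
- move=> s t u; rewrite /poly_star !muB lie_poisson_skew //.
  exact: bilNl.
Qed.

Lemma poly_iota_hom : loday_hom br (poly_bracket br) (poly_iota br).
Proof.
split=> [|x y]; first exact: pB.1.
by rewrite /poly_bracket poly_mu_pure mul1r poly_der_ext_gen poly_der_sbar.
Qed.

End PolynomialAlgebra.

(** * Linear maps vanishing on symmetrized brackets *)

Section LieDescent.
Variables (K : fieldType) (g M : lmodType K) (br : g -> g -> g) (F : g -> M).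
Hypothesis lF : linear F.
Hypothesis F_sym : forall x y, F (br x y + br y x) = 0.

Lemma lin_repr_bar x : F (repr (bar br x)) = F x.
Proof.
apply/eqP; rewrite -subr_eq0 -(linB lF).
have /asboolP[s ->] := repr_bar br x.
by rewrite (lin_sum lF) big1 // => i _; rewrite (linZ lF) F_sym scaler0.
Qed.

(** F o repr is the map that F induces on g_Lie. *)
Lemma lin_repr_linear : linear (fun u : gLie br => F (repr u)).
Proof.
move=> a; elim/bar_ind=> x; elim/bar_ind=> y.
by rewrite -bar_linear !lin_repr_bar lF.
Qed.

End LieDescent.

(** * Extension of a Loday morphism to S(g_Lie) ⊗ g *)

Section Extension.
Variables (K : fieldType) (g : lmodType K) (br : g -> g -> g).
Hypothesis Hg : is_loday br.
Variables (P : lmodType K) (mulP brP : P -> P -> P).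

Local Notation S := {sym gLie br}.

(** Acting by xbar on A is multiplying on the left by iota x, so iota g
    generates A for the product. *)
Lemma star_hom_ext (F G : Apoly br -> P) : bilinear_op mulP ->
    linear F -> {morph F : t u / poly_star br t u >-> mulP t u} ->
    linear G -> {morph G : t u / poly_star br t u >-> mulP t u} ->
    (forall x, F (poly_iota br x) = G (poly_iota br x)) ->
  F =1 G.
Proof.
move=> mB lF FM lG GM FG.
have aB := poly_act_bilinear br.
have act_ext f t : F t = G t -> F (poly_act br f t) = G (poly_act br f t).
  elim/sym_ind: f t => [a|u|f h Ef Eh|f h Ef Eh] t Et.
  - by rewrite (action_cst _ _ (poly_action br)) (linZ lF) (linZ lG) Et.
  - elim/bar_ind: u => x.
    have -> : poly_act br (sgen (bar br x)) t = poly_star br (poly_iota br x) t.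
      by rewrite /poly_star poly_mu_pure mul1r.
    by rewrite FM GM FG Et.
  - by rewrite (bilDl aB) (linD lF) (linD lG) Ef // Eh.
  - by rewrite (actionM (poly_action br)); apply/Ef/Eh.
apply: tensor_linear_ext => // f y.
by rewrite -[f]mulr1 -poly_act_pure; apply/act_ext/FG.
Qed.

Hypothesis HP : is_dual_prePoisson mulP brP.
Variable phi : g -> P.
Hypothesis Hphi : loday_hom br brP phi.

Let mB : bilinear_op mulP := perm_bilinear (dpp_perm HP).
Let bB : bilinear_op brP := loday_bilinear (dpp_loday HP).
Let mA : associative mulP := perm_assoc (dpp_perm HP).
Let lphi : linear phi := Hphi.1.
Let phiB := Hphi.2.

Lemma mulPCA p q r : mulP p (mulP q r) = mulP q (mulP p r).
Proof. by rewrite !mA (perm_swap (dpp_perm HP)). Qed.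

Definition lie_mul (u : gLie br) (p : P) : P := mulP (phi (repr u)) p.

Let mul_phi_linear p : linear (fun x => mulP (phi x) p).
Proof. by move=> a x y; rewrite lphi (mB.2 p). Qed.
Let mul_phi_sym p x y : mulP (phi (br x y + br y x)) p = 0.
Proof.
by rewrite (linD lphi) !phiB (bilDl mB) (dpp_skew HP) addNr.
Qed.

Lemma lie_mul_bar x p : lie_mul (bar br x) p = mulP (phi x) p.
Proof. exact: (lin_repr_bar (mul_phi_linear p) (mul_phi_sym p)). Qed.

Lemma lie_mul_bilinear : bilinear_op lie_mul.
Proof.
split=> [u|p]; first exact: mB.1.
exact: (lin_repr_linear (mul_phi_linear p) (mul_phi_sym p)).
Qed.

Let lie_mulCA u v p : lie_mul u (lie_mul v p) = lie_mul v (lie_mul u p).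
Proof. exact: mulPCA. Qed.

Definition ext_act : S -> P -> P := symact lie_mul.

Let eA : is_action ext_act := symact_action lie_mul_bilinear lie_mulCA.
Let eB : bilinear_op ext_act := action_bilinear eA.
Let eM f h p : ext_act (f * h) p = ext_act f (ext_act h p).
Proof. exact: actionM. Qed.

Lemma ext_act_sbar x p : ext_act (sbar br x) p = mulP (phi x) p.
Proof.
by rewrite /ext_act (symact_gen lie_mul_bilinear lie_mulCA) lie_mul_bar.
Qed.

Lemma ext_act_mull f p q : mulP (ext_act f p) q = ext_act f (mulP p q).
Proof.
elim/sym_ind: f p => [a|u|f h Ef Eh|f h Ef Eh] p.
- by rewrite !(action_cst _ _ eA) (bilZl mB).
- by elim/bar_ind: u => x; rewrite !ext_act_sbar mA.
- by rewrite !(bilDl eB) (bilDl mB) Ef Eh.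
- by rewrite !eM Ef Eh.
Qed.

Lemma ext_act_mulr f p q : mulP p (ext_act f q) = ext_act f (mulP p q).
Proof.
elim/sym_ind: f q => [a|u|f h Ef Eh|f h Ef Eh] q.
- by rewrite !(action_cst _ _ eA) (bilZr mB).
- by elim/bar_ind: u => x; rewrite !ext_act_sbar mulPCA.
- by rewrite !(bilDl eB) (bilDr mB) Ef Eh.
- by rewrite !eM Ef Eh.
Qed.

Let br_phi_linear p : linear (fun x => brP (phi x) p).
Proof. by move=> a x y; rewrite lphi (bB.2 p). Qed.
(* In the sum of the Leibniz identities for (phi x, phi y) and (phi y, phi x),
   everything cancels but the left-hand side. *)
Let br_phi_sym p x y : brP (phi (br x y + br y x)) p = 0.
Proof.
rewrite (linD lphi) !phiB (bilDl bB).
have := loday_leibniz (dpp_loday HP) (phi x) (phi y) p.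
rewrite (loday_leibniz (dpp_loday HP) (phi y)) addrA.
by rewrite -[LHS]add0r => /addIr <-.
Qed.

(** This is E_f p. For P = S(g_Lie) ⊗ g and phi = iota it is {f, p}, so it stands
    for the bracket with an element f that P itself need not contain. *)
Definition ext_der (f : S) (p : P) : P :=
  symder ext_act (fun u : gLie br => brP (phi (repr u)) p) f.

Let dl p := lin_repr_linear (br_phi_linear p) (br_phi_sym p).

Lemma ext_der_linear p : linear (ext_der ^~ p).
Proof. exact: (symder_linear eA (dl p)). Qed.
Lemma ext_derM f h p :
  ext_der (f * h) p = ext_act f (ext_der h p) + ext_act h (ext_der f p).
Proof. exact: (symderM eA (dl p)). Qed.
Lemma ext_der_cst a p : ext_der a%:A p = 0.
Proof. exact: (symder_cst eA (dl p)). Qed.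
Lemma ext_der_sbar x p : ext_der (sbar br x) p = brP (phi x) p.
Proof.
rewrite /ext_der (symder_gen eA (dl p)).
exact: (lin_repr_bar (br_phi_linear p) (br_phi_sym p)).
Qed.

(** Iterated axiom (ii): for f = x1bar ... xnbar, the element f . p is
    phi x1 * ... * phi xn * p, and E_f collects the terms in which the bracket
    hits one of the phi xi. *)
Lemma br_ext_actl f p q :
  brP (ext_act f p) q = ext_act f (brP p q) + mulP p (ext_der f q).
Proof.
elim/sym_ind: f p => [a|u|f h Ef Eh|f h Ef Eh] p.
- by rewrite !(action_cst _ _ eA) ext_der_cst (bil0r mB) addr0 (bilZl bB).
- elim/bar_ind: u => x.
  by rewrite !ext_act_sbar ext_der_sbar (dpp_derl HP).
- rewrite !(bilDl eB) (bilDl bB) (linD (ext_der_linear q)) (bilDr mB) Ef Eh.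
  exact: addrACA.
- rewrite eM Ef Eh eM ext_derM (bilDr mB) (bilDr eB) -addrA; congr (_ + _).
  by rewrite ext_act_mull !ext_act_mulr.
Qed.

(** Iterated axiom (i), with {phi x, phi z} = phi [x, z] absorbed into the
    Poisson bracket of S. *)
Lemma br_phi_ext_act x h p : brP (phi x) (ext_act h p) =
  ext_act (lie_poisson br (sbar br x) h) p + ext_act h (brP (phi x) p).
Proof.
have lB := lie_poisson_bilinear Hg.
elim/sym_ind: h p => [a|u|f h Ef Eh|f h Ef Eh] p.
- rewrite (bilZr lB) lie_poisson_one // scaler0 (bil0l eB) add0r.
  by rewrite !(action_cst _ _ eA) (bilZr bB).
- elim/bar_ind: u => z.
  rewrite -[sgen _]/(sbar br z) lie_poisson_sbar // !ext_act_sbar.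
  by rewrite (dpp_derr HP) phiB.
- by rewrite !(bilDl eB) (bilDr bB) (bilDr lB) (bilDl eB) Ef Eh; exact: addrACA.
- rewrite eM Ef Eh lie_poisson_derr // (bilDl eB) !eM (bilDr eB).
  exact: addrA.
Qed.

Definition ext_hom : Apoly br -> P := tlift (fun f y => ext_act f (phi y)).

Let ext_bilinear : bilinear_op (fun f y => ext_act f (phi y)).
Proof. by split=> [f|y] a u v; [rewrite lphi eB.1 | exact: eB.2]. Qed.

Lemma ext_hom_pure f y : ext_hom (f ⊗ y) = ext_act f (phi y).
Proof. exact: (tlift_pure ext_bilinear). Qed.

Lemma ext_hom_linear : linear ext_hom.
Proof. exact: (tlift_linear ext_bilinear). Qed.

Lemma ext_hom_act f t : ext_hom (poly_act br f t) = ext_act f (ext_hom t).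
Proof.
move: t; apply: tensor_linear_ext => [a s t|a s t|k y].
- by rewrite (poly_act_bilinear br).1 ext_hom_linear.
- by rewrite ext_hom_linear eB.1.
- by rewrite poly_act_pure !ext_hom_pure eM.
Qed.

Lemma ext_act_mu t p : ext_act (poly_mu br t) p = mulP (ext_hom t) p.
Proof.
move: t; apply: tensor_linear_ext => [a s t|a s t|k y].
- by rewrite poly_mu_linear eB.2.
- by rewrite ext_hom_linear mB.2.
- by rewrite poly_mu_pure ext_hom_pure eM ext_act_sbar ext_act_mull.
Qed.

Lemma ext_der_mu t p : ext_der (poly_mu br t) p = brP (ext_hom t) p.
Proof.
move: t; apply: tensor_linear_ext => [a s t|a s t|k y].
- by rewrite poly_mu_linear ext_der_linear.
- by rewrite ext_hom_linear bB.2.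
- rewrite poly_mu_pure ext_hom_pure ext_derM ext_act_sbar ext_der_sbar.
  by rewrite br_ext_actl.
Qed.

(** Both sides are derivations in f since ext_hom is a module map; for f = xbar
    it is br_phi_ext_act. *)
Lemma ext_hom_der_ext f t :
  ext_hom (poly_der_ext br f t) = ext_der f (ext_hom t).
Proof.
have DB := poly_der_ext_bilinear Hg.
elim/sym_ind: f t => [a|u|f h Ef Eh|f h Ef Eh] t.
- rewrite ext_der_cst (poly_der_ext_cst Hg); exact: (lin0 ext_hom_linear).
- elim/bar_ind: u => x; rewrite -[sgen _]/(sbar br x) ext_der_sbar.
  move: t; apply: tensor_linear_ext => [a s t|a s t|k y].
  + by rewrite DB.1 ext_hom_linear.
  + by rewrite ext_hom_linear bB.1.
  + rewrite poly_der_ext_pure // (linD ext_hom_linear) ext_hom_act.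
    by rewrite poly_der_sbar // !ext_hom_pure (action1 eA) phiB br_phi_ext_act.
- by rewrite (bilDl DB) (linD ext_hom_linear) Ef Eh (linD (ext_der_linear _)).
- rewrite poly_der_extMl // (linD ext_hom_linear) !ext_hom_act Ef Eh.
  by rewrite ext_derM.
Qed.

Lemma ext_hom_iota x : ext_hom (poly_iota br x) = phi x.
Proof. by rewrite ext_hom_pure (action1 eA). Qed.

Lemma ext_hom_dual_prePoisson_hom :
  dual_prePoisson_hom (poly_star br) (poly_bracket br) mulP brP ext_hom.
Proof.
split=> [|t u|t u]; first exact: ext_hom_linear.
- by rewrite /poly_star ext_hom_act ext_act_mu.
- by rewrite /poly_bracket ext_hom_der_ext ext_der_mu.
Qed.

End Extension.

Theorem theorem4p4 (K : fieldType) (charK0 : [pchar K] =i pred0)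
    (g : lmodType K) (br : g -> g -> g) (Hg : is_loday br) :
  [/\ is_dual_prePoisson (poly_star br) (poly_bracket br),
      injective (poly_iota br) /\ loday_hom br (poly_bracket br) (poly_iota br)
    & forall (P : lmodType K) (mulP brP : P -> P -> P),
        is_dual_prePoisson mulP brP ->
      forall phi : g -> P, loday_hom br brP phi ->
      exists! phihat : Apoly br -> P,
        dual_prePoisson_hom (poly_star br) (poly_bracket br) mulP brP phihat
        /\ phihat \o poly_iota br = phi].
Proof.
split; first exact: poly_dual_prePoisson.
- split; last exact: poly_iota_hom.
  (* g with the zero product is dual-prePoisson, so id : g -> g extends to a
     retraction of iota. *)
  pose zero (_ _ : g) : g := 0.
  have Hzero : is_dual_prePoisson zero br.
    have zlin : linear (fun _ : g => 0 : g).
      by move=> a x y; rewrite scaler0 addr0.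
    have [bl br0] := loday_bilinear Hg.
    split=> //; rewrite /zero => *; rewrite ?oppr0 ?addr0 //.
    + exact: (lin0 (bl _)).
    + exact: (lin0 (br0 _)).
  have idhom : loday_hom br br id by [].
  exact: (can_inj (ext_hom_iota Hzero idhom)).
move=> P mulP brP HP phi Hphi; exists (ext_hom (br := br) mulP phi).
split=> [|F [[lF FM _] Fi]].
  split; first exact: ext_hom_dual_prePoisson_hom.
  by apply/funext => x; exact: (ext_hom_iota HP Hphi).
have [lE EM _] := ext_hom_dual_prePoisson_hom Hg HP Hphi.
apply/funext/(star_hom_ext (perm_bilinear (dpp_perm HP))) => // x.
by rewrite (ext_hom_iota HP Hphi) -Fi.
Qed.
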